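(* Let $C(n)$ be the number of distinct cubes in the prefix $\mathbb{T}[1,n]$ of the Tribonacci sequence. Then $C(n)=0$ for $n\le 57$. For $n\ge 58$, let $m$ be the positive integer such that $t_{m-1}+2t_{m-4}\le n<t_m+2t_{m-3}$; then $m\ge 7$ and $$C(n)=\begin{cases} n-\frac12(3t_{m-2}+t_{m-3}+4t_{m-4}+m-6), & n\le \frac{3t_{m-1}-t_{m-3}-3}{2};\\ \frac12(t_{m-5}+t_{m-6}-m+3), & \text{otherwise}.\end{cases}$$
   Context: The Tribonacci substitution $\sigma$ on the alphabet $\{a,b,c\}$ is $\sigma(a)=ab$, $\sigma(b)=ac$, $\sigma(c)=a$. The Tribonacci sequence $\mathbb{T}$ is the infinite word that is the fixed point of $\sigma$ beginning with $a$; $\mathbb{T}[1,n]$ is its prefix of length $n$ ($\mathbb{T}[1,0]$ is empty). Put $T_{-2}=\epsilon$ (empty word), $T_{-1}=c$, $T_m=\sigma^m(a)$ for $m\ge0$, $t_m=|T_m|$ for $m\ge-2$, and $t_{-3}=0$; thus $t_{-3}=t_{-2}=0$, $t_{-1}=t_0=1$, $t_1=2$, $t_2=4$, $t_3=7$, $t_4=13$, and $t_m=t_{m-1}+t_{m-2}+t_{m-3}$ for $m\ge1$. Write $u\prec v$ if $u$ is a factor (contiguous subword) of $v$. Then $C(n)=\#\{\omega \mid \omega \text{ non-empty word},\ \omega\omega\omega\prec\mathbb{T}[1,n]\}$ for $n\ge0$. *)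

(* Defs.v *)
From HB Require Import structures.
From mathcomp Require Import all_boot all_order all_algebra.

Set Implicit Arguments.
Unset Strict Implicit.
Unset Printing Implicit Defensive.

Inductive letter := a | b | c.

Definition letter_code (x : letter) : nat :=
  match x with a => 0 | b => 1 | c => 2 end.

Definition letter_decode (i : nat) : letter :=
  match i with 0 => a | 1 => b | _ => c end.

Lemma letter_codeK : cancel letter_code letter_decode.
Proof. by case. Qed.

HB.instance Definition _ := Equality.copy letter (can_type letter_codeK).

Definition sigma1 (x : letter) : seq letter :=
  match x with a => [:: a; b] | b => [:: a; c] | c => [:: a] end.

Definition sigma (u : seq letter) : seq letter := flatten (map sigma1 u).

(* Infinite words are functions [nat -> letter] indexed from 0, so the prefix
   w[1,n] is [mkseq w n]. Since [sigma] is non-erasing, sigma(w) is the unique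
   infinite word having all the sigma(w[1,n]) as prefixes; thus the first
   conjunct says sigma(w) = w. *)
Definition tribonacci_word (w : nat -> letter) : Prop :=
  (forall n, sigma (mkseq w n) = mkseq w (size (sigma (mkseq w n))))
  /\ w 0 = a.

(* T_m and t_m = |T_m| are indexed by integers; the value of [T] at -3 is the
   empty word, so that t_{-3} = 0. Indices below -3 are not used. *)
Definition T (m : int) : seq letter :=
  match m with
  | Posz k => iter k sigma [:: a]
  | Negz 0 => [:: c]
  | Negz _ => [::]
  end.

Definition t (m : int) : nat := size (T m).
Arguments T m%_R.
Arguments t m%_R.

Definition factors (s : seq letter) : seq (seq letter) :=
  [seq take l (drop i s) | i <- iota 0 (size s).+1, l <- iota 0 (size s).+1].

(* Duplicate-free list of the non-empty u such that uuu is a factor of s. *)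
Definition cube_roots (s : seq letter) : seq (seq letter) :=
  undup [seq u <- factors s | (u != [::]) && infix (u ++ u ++ u) s].

Definition C (w : nat -> letter) (n : nat) : nat := size (cube_roots (mkseq w n)).

Lemma mem_factors s u : (u \in factors s) = infix u s.
Proof.
apply/allpairsP/idP => [[[i l] /= [_ _ ->]]|/infixP[p [q def_s]]].
  exact: infix_trans (prefixW (prefix_take _ _)) (suffixW (suffix_drop _ _)).
have iotaE m n : (m \in iota 0 n) = (m < n) by rewrite mem_iota.
exists (size p, size u); rewrite def_s; split.
- by rewrite iotaE ltnS size_cat leq_addr.
- by rewrite iotaE ltnS !size_cat addnCA leq_addr.
- by rewrite /= drop_size_cat // take_size_cat.
Qed.

Lemma cube_roots_uniq s : uniq (cube_roots s).
Proof. exact: undup_uniq. Qed.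

Lemma mem_cube_roots s u :
  (u \in cube_roots s) = (u != [::]) && infix (u ++ u ++ u) s.
Proof.
rewrite mem_undup mem_filter mem_factors andb_idr // => /andP[_].
by apply: infix_trans; apply: prefixW; apply: prefix_prefix.
Qed.

Lemma sigma_cat u v : sigma (u ++ v) = sigma u ++ sigma v.
Proof. by rewrite /sigma map_cat flatten_cat. Qed.

Lemma size_sigma u : size u <= size (sigma u).
Proof.
by elim: u => //= x u IH; rewrite /sigma /= size_cat -add1n leq_add //; case: x.
Qed.

Lemma prefix_sigma u v : prefix u v -> prefix (sigma u) (sigma v).
Proof. by case/prefixP => q ->; rewrite sigma_cat prefix_prefix. Qed.

Lemma prefix_T (k : nat) : prefix (T k) (T k.+1).
Proof. by elim: k => [//|k IH]; exact: prefix_sigma IH. Qed.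

Lemma prefix_T_leq (k l : nat) : k <= l -> prefix (T k) (T l).
Proof.
elim: l => [|l IH]; first by rewrite leqn0 => /eqP->; apply: prefix_refl.
rewrite leq_eqVlt => /predU1P[->|/IH kl]; first exact: prefix_refl.
exact: prefix_trans kl (prefix_T l).
Qed.

Lemma head_T (k : nat) : exists q, T k = a :: q.
Proof.
by have /prefixP[q ->] := prefix_T_leq (leq0n k); exists q.
Qed.

Lemma size_T_gt (k : nat) : k < t k.
Proof.
elim: k => // k IH; apply: leq_ltn_trans IH _; rewrite /t.
have -> : T k.+1 = sigma (T k) by [].
have [q ->] := head_T k.
by rewrite /sigma /= !ltnS size_sigma.
Qed.

Lemma tribonacci_word_exists : exists w, tribonacci_word w.
Proof.
pose w (i : nat) := nth a (T i) i.
have wE i (k : nat) : i < t k -> w i = nth a (T k) i.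
  move=> ik; rewrite /w; have [le_ik|/ltnW le_ki] := leqP i k.
    by have /prefixP[q ->] := prefix_T_leq le_ik; rewrite nth_cat size_T_gt.
  by have /prefixP[q ->] := prefix_T_leq le_ki; rewrite nth_cat ik.
have prefE n (k : nat) : n <= t k -> mkseq w n = take n (T k).
  move=> nk; apply: (@eq_from_nth _ a).
    by rewrite size_mkseq size_takel.
  move=> i; rewrite size_mkseq => lt_in.
  by rewrite nth_mkseq // nth_take //; apply: wE; apply: leq_trans nk.
exists w; split=> // n.
have nn : n <= t n by apply/ltnW/size_T_gt.
have /prefix_sigma : prefix (mkseq w n) (T n).
  by rewrite (prefE n n) // prefix_take.
set u := sigma _ => pre_u; rewrite (prefE _ n.+1); last exact: size_prefix pre_u.
by have /prefixP[q /= ->] := pre_u; rewrite take_size_cat.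
Qed.

Lemma tribonacci_word_unique w w' :
  tribonacci_word w -> tribonacci_word w' -> w =1 w'.
Proof.
move=> [fw w0] [fw' w'0] i.
suff: mkseq w i.+1 = mkseq w' i.+1.
  by move/(congr1 (fun u => nth a u i)); rewrite !nth_mkseq.
elim: i => [|i IH]; first by rewrite /mkseq /= w0 w'0.
have lt_sz : i.+2 <= size (sigma (mkseq w i.+1)).
  rewrite /mkseq /= w0 /sigma /= !ltnS; apply: leq_trans (size_sigma _).
  by rewrite size_map size_iota.
have eq_w : mkseq w (size (sigma (mkseq w i.+1)))
          = mkseq w' (size (sigma (mkseq w i.+1))).
  by rewrite -fw IH -fw'.
have := congr1 (take i.+2) eq_w.
by rewrite /mkseq -!map_take !take_iota (minn_idPl lt_sz).
Qed.

(* Main.v *)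
Require Import Defs.
From mathcomp Require Import all_boot all_order all_algebra.
From mathcomp Require Import zify lra.

Import Order.TTheory GRing.Theory Num.Theory.

(* Write blk n for the length of sigma(w[0,n)), w being indexed from 0. A
   repetition of period p starting at i that cannot be extended to the left
   desubstitutes until nothing repeats: i = blk^k(i0), i + p = blk^k(i0 + p0),
   and the repeating word is a prefix of the palindromic prefix
   T_(k-1) ... T_1 T_0 of w. Comparing lengths, such a repetition contains a cube
   only if w[i0, i0 + p0) = c, so the root has length t_K with K = k - 1, and all
   repetitions with root length t_K carry the same word. As the first c of w is
   at position 3, the cubes with roots of length t_K first occur at consecutive
   positions, ending at t_(K+3) + 2 t_K and after, and it remains to count. *)

(** * Lengths of the words sigma^k(x) *)

Lemma iter_sigma_cat k u v :
  iter k sigma (u ++ v) = iter k sigma u ++ iter k sigma v.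
Proof. by elim: k => //= k ->; rewrite sigma_cat. Qed.

(* Locked because conversion would otherwise compare the words T_k themselves. *)
Definition trib : nat -> nat := locked (fun k : nat => t k).

Lemma tribE (k : nat) : t k = trib k.
Proof. by rewrite /trib -lock. Qed.

Lemma size_iter_sigma_a k : size (iter k sigma [:: a]) = trib k.
Proof. by rewrite -tribE. Qed.

Lemma size_iter_sigma_b k :
  size (iter k.+1 sigma [:: b]) = trib k + size (iter k sigma [:: c]).
Proof.
by rewrite iterSr -[sigma _]/([:: a] ++ [:: c]) iter_sigma_cat size_cat
  size_iter_sigma_a.
Qed.

Lemma size_iter_sigma_c k : size (iter k.+1 sigma [:: c]) = trib k.
Proof. by rewrite iterSr -size_iter_sigma_a. Qed.

Lemma tribSSS k : trib k.+3 = trib k.+2 + trib k.+1 + trib k.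
Proof.
rewrite -!size_iter_sigma_a !(iterSr, iterSr k).
(* sigma^3(a) = sigma^2(a) sigma(a) a. *)
rewrite -[sigma (sigma (sigma _))]/([:: a; b; a; c] ++ [:: a; b] ++ [:: a]).
by rewrite !iter_sigma_cat !size_cat addnA.
Qed.

Lemma trib_gt k : k < trib k.
Proof. by rewrite -tribE size_T_gt. Qed.

Lemma trib0 : trib 0 = 1. Proof. by rewrite -tribE. Qed.
Lemma trib1 : trib 1 = 2. Proof. by rewrite -tribE. Qed.
Lemma trib2 : trib 2 = 4. Proof. by rewrite -tribE. Qed.

Lemma trib_ltS k : trib k < trib k.+1.
Proof.
case: k => [|[|k]]; rewrite ?trib0 ?trib1 ?trib2 //.
by move: (tribSSS k) (trib_gt k) (trib_gt k.+1); lia.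
Qed.

Lemma trib_add_lt k : trib k.+1 + trib k < trib k.+2.
Proof.
case: k => [|k]; first by rewrite trib0 trib1 trib2.
by move: (tribSSS k) (trib_gt k); lia.
Qed.

Lemma trib_double k : trib k.+1 <= 2 * trib k.
Proof.
case: k => [|[|k]]; rewrite ?trib0 ?trib1 ?trib2 //.
by move: (tribSSS k) (trib_add_lt k); lia.
Qed.

Lemma trib_mono : {mono trib : m n / m <= n}.
Proof.
apply: leq_mono; apply: homo_ltn => [y x z|k]; [exact: ltn_trans | exact: trib_ltS].
Qed.

Lemma trib_inj : injective trib.
Proof. exact: incn_inj trib_mono. Qed.

(** * Palindromic prefixes and their lengths *)

Fixpoint pal (k : nat) : seq letter :=
  if k is k'.+1 then rcons (sigma (pal k')) a else [::].

Definition pal_size : nat -> nat := locked (fun k => size (pal k)).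

Lemma size_pal k : size (pal k) = pal_size k.
Proof. by rewrite /pal_size -lock. Qed.

(** [pal] is defined by u -> sigma(u)a because a match grows that way in [matches_blk]; the form
    T_(k-1) ... T_0 makes its length a sum of Tribonacci numbers. *)
Lemma pal_T (k : nat) : pal k.+1 = T k ++ pal k.
Proof.
elim: k => // k IH.
have -> : pal k.+2 = rcons (sigma (pal k.+1)) a by [].
by rewrite {1}IH sigma_cat rcons_cat.
Qed.

Lemma pal_size0 : pal_size 0 = 0. Proof. by rewrite -size_pal. Qed.

Lemma pal_sizeS (k : nat) : pal_size k.+1 = trib k + pal_size k.
Proof. by rewrite -!size_pal pal_T size_cat -tribE. Qed.

Lemma pal_size_closed (k : nat) : 2 * pal_size k.+1 + 3 = trib k.+2 + trib k.
Proof.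
elim: k => [|k IH]; first by rewrite pal_sizeS pal_size0 trib0 trib2.
by rewrite pal_sizeS; move: (tribSSS k) IH; lia.
Qed.

(** * Arithmetic of the numbers of cubes and of their first ends *)

(* The cubes with roots of length t_K have cube_number K distinct roots; their
   first occurrences end at the consecutive positions from first_end K on. *)
Definition first_end K := trib K.+3 + 2 * trib K.
Definition cube_number K := (pal_size K.+1).+1 - 2 * trib K.

Lemma cube_number_closed K : 2 * cube_number K + 3 * trib K + 1 = trib K.+2.
Proof.
(* This keeps the subtraction in [cube_number] from truncating. *)
suff gt3 : 3 * trib K < trib K.+2.
  by rewrite /cube_number; move: (pal_size_closed K); lia.
move: (tribSSS 0) (tribSSS 1); rewrite trib0 trib1 trib2 => t3 t4.
case: K => [|[|[|K]]]; rewrite ?t4 ?t3 ?trib0 ?trib1 ?trib2 //.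
move: (tribSSS K) (tribSSS K.+1) (tribSSS K.+2) (trib_ltS K) (trib_ltS K.+1).
lia.
Qed.

(** The sum telescopes from j = 0, where it is 0: there are no cubes with roots of length t_0, t_1
    or t_2. *)
Lemma sum_cube_number j :
  2 * (\sum_(0 <= K < j.+3) cube_number K) + j + 3 = trib j.+1 + trib j.
Proof.
move: (tribSSS 0) (tribSSS 1); rewrite trib0 trib1 trib2 => t3 t4.
elim: j => [|j IH].
  rewrite !big_nat_recr //= big_geq // trib0 trib1.
  move: (cube_number_closed 0) (cube_number_closed 1) (cube_number_closed 2).
  by rewrite t4 t3 trib0 trib1 trib2; lia.
rewrite big_nat_recr //=; move: IH; set s := (\sum_(0 <= K < j.+3) _).
move: (cube_number_closed j.+3) (tribSSS j) (tribSSS j.+1) (tribSSS j.+2).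
by lia.
Qed.

Lemma first_end_lt K : first_end K < first_end K.+1.
Proof.
by rewrite /first_end; move: (trib_ltS K) (trib_ltS K.+3); lia.
Qed.

Lemma first_end_mono : {mono first_end : m n / m <= n}.
Proof.
apply: leq_mono; apply: homo_ltn => [y x z|k]; first exact: ltn_trans.
exact: first_end_lt.
Qed.

Lemma first_end3 : first_end 3 = 58.
Proof. by rewrite /first_end -!tribE. Qed.

(** All roots of one length have appeared before the first root of the next length, so at most one
    length is partly counted in a prefix. *)
Lemma last_end_lt K : first_end K + cube_number K <= first_end K.+1.
Proof.
rewrite /first_end.
by move: (cube_number_closed K) (tribSSS K.+1) (tribSSS K) (trib_ltS K); lia.
Qed.

Lemma first_end_bracket n : 58 <= n ->
  exists j, first_end j.+3 <= n < first_end j.+4.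
Proof.
elim: n => // n IH; rewrite leq_eqVlt => /predU1P[<-|/IH[j /andP[lo hi]]].
  by exists 0; rewrite -first_end3 leqnn first_end_lt.
have [lt|ge] := ltnP n.+1 (first_end j.+4); first by exists j; rewrite leqW.
by exists j.+1; rewrite ge; move: (first_end_lt j.+4); lia.
Qed.

(** * Blocks sigma(x) of the infinite word *)

Section TribonacciWord.

Set Implicit Arguments.
Unset Strict Implicit.

Variables (w : nat -> letter) (hw : tribonacci_word w).

Definition blk (n : nat) : nat := size (sigma (mkseq w n)).

Lemma sigma_prefix n : sigma (mkseq w n) = mkseq w (blk n).
Proof. by case: hw => + _; apply. Qed.

Lemma w0 : w 0 = a. Proof. by case: hw. Qed.

Lemma blk0 : blk 0 = 0. Proof. by []. Qed.

Lemma blkS n : blk n.+1 = blk n + size (sigma1 (w n)).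
Proof. by rewrite /blk mkseqS -cats1 sigma_cat size_cat /= /sigma /= cats0. Qed.

Lemma w_sigma1 n x : x < size (sigma1 (w n)) ->
  w (blk n + x) = nth a (sigma1 (w n)) x.
Proof.
move=> hx; have hS : blk n + x < blk n.+1 by rewrite blkS ltn_add2l.
rewrite -[LHS](nth_mkseq a w hS) -sigma_prefix mkseqS -cats1 sigma_cat.
by rewrite nth_cat -/(blk n) ltnNge leq_addr addKn /sigma /= cats0.
Qed.

Lemma blk_lt n : blk n < blk n.+1.
Proof. by rewrite blkS; case: (w n) => /=; lia. Qed.

Lemma blk_mono : {mono blk : m n / m <= n}.
Proof.
apply: leq_mono; apply: homo_ltn => [y x z|n]; [exact: ltn_trans | exact: blk_lt].
Qed.

Lemma w_blk n : w (blk n) = a.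
Proof. by rewrite -[blk n]addn0 w_sigma1; case: (w n). Qed.

(* The second letter of sigma(x)a. *)
Definition second (x : letter) := match x with a => b | b => c | c => a end.

Lemma second_inj : injective second.
Proof. by case; case. Qed.

Lemma w_blkS n : w (blk n).+1 = second (w n).
Proof.
case def_x: (w n); last by have := w_blk n.+1; rewrite blkS def_x addn1.
  by rewrite -addn1 w_sigma1 def_x.
by rewrite -addn1 w_sigma1 def_x.
Qed.

(** The second letter of sigma(x)a is also the last letter of sigma(x), so distinct blocks end in
    distinct letters. *)
Lemma w_pred_blk n : w (blk n.+1).-1 = second (w n).
Proof.
rewrite blkS; case def_x: (w n).
- by rewrite addnS /= addn1 w_blkS def_x.
- by rewrite addnS /= addn1 w_blkS def_x.
by rewrite addn1 /= w_blk.
Qed.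

Lemma blk_decomp q : exists n, q = blk n \/ q = (blk n).+1 /\ w n <> c.
Proof.
elim: q => [|q [n [->|[-> wn]]]]; first by exists 0; left.
  case def_x: (w n); last by exists n.+1; left; rewrite blkS def_x addn1.
    by exists n; right; rewrite def_x.
  by exists n; right; rewrite def_x.
by exists n.+1; left; rewrite blkS; case: (w n) wn => //=; rewrite addn2.
Qed.

Lemma w_eq_a q : w q = a -> exists n, q = blk n.
Proof.
have [n [->|[->]]] := blk_decomp q; first by exists n.
by rewrite w_blkS; case: (w n).
Qed.

Lemma w_neq_a q : w q <> a -> 0 < q /\ w q.-1 = a.
Proof.
have [n [->|[->]]] := blk_decomp q; first by rewrite w_blk.
by rewrite /= w_blk.
Qed.

(** * Repetitions and their desubstitution *)

Definition matches (i j L : nat) := forall x, x < L -> w (i + x) = w (j + x).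

(** The extra position is the a that opens the next block on both sides, whatever that block is. *)
Lemma matches_blk i j L : matches i j L ->
  blk (i + L) - blk i = blk (j + L) - blk j /\
  matches (blk i) (blk j) (blk (i + L) - blk i).+1.
Proof.
elim: L => [|L IH] m.
  rewrite !addn0 !subnn; split=> // x; rewrite ltnS leqn0 => /eqP->.
  by rewrite !addn0 !w_blk.
have {IH}[eqS mS] := IH (fun x hx => m x (ltnW hx)).
have eqw := m L (leqnn _).
have lei : blk i <= blk (i + L) by rewrite blk_mono leq_addr.
have lej : blk j <= blk (j + L) by rewrite blk_mono leq_addr.
rewrite !addnS !blkS -eqw; split; first lia.
move=> x hx.
case: (ltnP x (blk (i + L) - blk i).+1) => [/mS //|hx'].
have [{hx'}->|hx2] := eqVneq x (blk (i + L) - blk i).+1.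
  rewrite !addnS (subnKC lei) eqS (subnKC lej) !w_blkS.
  by rewrite eqw.
have def_x : x = blk (i + L).+1 - blk i.
  by move: hx hx2 hx'; rewrite blkS; case: (w (i + L)) => /=; lia.
have -> : blk i + x = blk (i + L).+1 by move: def_x (blk_lt (i + L)); lia.
have -> : blk j + x = blk (j + L).+1.
  by move: def_x (blk_lt (i + L)); rewrite !blkS -eqw; lia.
by rewrite !w_blk.
Qed.

Lemma iter_sigma_prefix k n : iter k sigma (mkseq w n) = mkseq w (iter k blk n).
Proof. by elim: k => //= k ->; rewrite sigma_prefix. Qed.

Lemma iter_blk k n : iter k blk n = size (iter k sigma (mkseq w n)).
Proof. by rewrite iter_sigma_prefix size_mkseq. Qed.

Lemma iter_blk_succ k n :
  iter k blk n.+1 = iter k blk n + size (iter k sigma [:: w n]).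
Proof. by rewrite !iter_blk mkseqS -cats1 iter_sigma_cat size_cat. Qed.

Lemma iter_blk_mono k : {mono iter k blk : m n / m <= n}.
Proof. by elim: k => //= k IH m n; rewrite blk_mono IH. Qed.

Lemma pal_prefix k : pal k = mkseq w (pal_size k).
Proof.
suff [n pal_n] : exists n, pal k = mkseq w n.
  by rewrite -size_pal pal_n size_mkseq.
elim: k => [|k [n IH]]; first by exists 0.
by exists (blk n).+1; rewrite mkseqS w_blk -sigma_prefix -IH.
Qed.

Lemma pal_size_blk k : pal_size k.+1 = (blk (pal_size k)).+1.
Proof. by rewrite -size_pal /= size_rcons pal_prefix. Qed.

(* Desubstituting a repetition that cannot be extended to the left: starts of
   blocks sigma(x) are the occurrences of a, distinct blocks end in distinct
   letters, and sigma(x)a, sigma(y)a differ in their second letter. *)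
Lemma descent L i p : 0 < p -> matches i (i + p) L ->
    (i = 0 \/ w i.-1 <> w (i + p).-1) ->
  exists k i0 p0, [/\ 0 < p0, i = iter k blk i0, i + p = iter k blk (i0 + p0),
    L <= pal_size k & matches 0 i L].
Proof.
elim/ltn_ind: L i p => -[|L] IH i p p_gt0 m lmax.
  by exists 0, i, p; split=> // x.
have eq_i : w i = w (i + p) by rewrite -[i in LHS]addn0 m // addn0.
(* Any other letter is preceded by a on both sides, so the match would extend to the left. *)
have wi : w i = a.
  have [//|/eqP wi_neq] := eqVneq (w i) a.
  have [i_gt0 wi1] := w_neq_a wi_neq.
  have [|_ wip1] := @w_neq_a (i + p); first by rewrite -eq_i.
  by case: lmax => [i0|]; [rewrite i0 in i_gt0 | rewrite wi1 wip1].
have [i' def_i] := w_eq_a wi.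
have [j' def_j] : exists j', i + p = blk j' by apply: w_eq_a; rewrite -eq_i.
have lt_ij : i' < j' by rewrite -(leqW_mono blk_mono) -def_i -def_j; lia.
(* Pull back block by block until L letters are covered. Before that, the second letter at the next
   block start still lies in the match of length L + 1, and it determines the block. *)
have ex_L' : exists L', L' <= L /\ matches i' j' L' /\ L <= blk (i' + L') - blk i'.
  suff step n : n <= L -> (exists L', L' <= n /\ matches i' j' L' /\
      L <= blk (i' + L') - blk i') \/
    (matches i' j' n /\ n <= blk (i' + n) - blk i').
    by case: (step L (leqnn L)) => // -[mL leL]; exists L.
  elim: n => [|n IHn] hn; first by right; split=> // x.
  have [[L' [le_L' hL']]|[mn len]] := IHn (ltnW hn).
    by left; exists L'; split=> //; apply: leqW.
  have [hL|hL] := leqP L (blk (i' + n) - blk i').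
    by left; exists n; split.
  have lei : blk i' <= blk (i' + n) by rewrite blk_mono leq_addr.
  right; split; last by rewrite addnS; move: (blk_lt (i' + n)); lia.
  move=> x; rewrite ltnS leq_eqVlt => /predU1P[->|/mn //].
  apply: second_inj; rewrite -!w_blkS.
  have [eqS _] := matches_blk mn.
  have lej : blk j' <= blk (j' + n) by rewrite blk_mono leq_addr.
  have := m (blk (i' + n) - blk i').+1; rewrite def_j def_i !addnS subnKC //.
  by rewrite eqS subnKC //; apply; lia.
have [L' [le_L' [mL' leL]]] := ex_L'.
have [| | | |k [i0 [p0 [p0_gt0 def_i' def_j' leLe m0]]]] := IH L' _ i' (j' - i').
- by rewrite ltnS.
- by rewrite subn_gt0.
- by rewrite subnKC // ltnW.
- rewrite subnKC; last exact: ltnW.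
  case: i' def_i lt_ij {mL' leL ex_L'} => [|i'] def_i; first by left.
  case: j' def_j => // j' def_j _; right=> /= eqw.
  case: lmax; first by rewrite def_i; have := blk_lt i'; lia.
  by apply; rewrite def_j def_i !w_pred_blk eqw.
have [eqS mS] := matches_blk m0.
rewrite add0n blk0 subn0 in eqS mS.
exists k.+1, i0, p0; split=> //=.
- by rewrite def_i def_i'.
- by rewrite def_j -def_j' subnKC // ltnW.
- rewrite pal_size_blk ltnS (leq_trans leL) // -eqS blk_mono //.
rewrite def_i => x hx; apply: mS; rewrite ltnS; move: hx; rewrite eqS; lia.
Qed.

(** * Repetitions long enough for a cube *)

Lemma w_after_c n : w n = c -> w n.+1 = a.
Proof.
move=> wn; have [//|/eqP wSn] := eqVneq (w n.+1) a.
by have [_] := w_neq_a wSn; rewrite /= wn.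
Qed.

Lemma w_prefix4 : mkseq w 4 = [:: a; b; a; c].
Proof.
have w1 : w 1 = b by rewrite -[1]/(blk 0).+1 w_blkS w0.
have S1 : blk 1 = 2 by rewrite blkS blk0 w0.
have w2 : w 2 = a by rewrite -S1 w_blk.
have w3 : w 3 = c by rewrite -S1 w_blkS w1.
by rewrite /mkseq /= w0 w1 w2 w3.
Qed.

Lemma w_c_ge3 n : w n = c -> 3 <= n.
Proof.
move=> wn; rewrite leqNgt; apply/negP => n_lt3.
have : nth a (mkseq w 4) n = c by rewrite nth_mkseq // ltnW.
by rewrite w_prefix4; case: n n_lt3 {wn} => [|[|[|]]].
Qed.

Lemma iter_blk4 k : iter k blk 4 = trib k.+2.
Proof. by rewrite iter_blk w_prefix4 -size_iter_sigma_a !iterSr. Qed.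

(** Locates the image under sigma^(k+1) of the first c: it ends the image of abac, and its length is
    t_k. *)
Lemma iter_blk3 k : iter k.+1 blk 3 + trib k = trib k.+3.
Proof.
have w3 : w 3 = c by rewrite -(nth_mkseq a w (isT : 3 < 4)) w_prefix4.
by rewrite -size_iter_sigma_c -w3 -iter_blk_succ iter_blk4.
Qed.

Lemma matches_left_max i p L : matches i (i + p) L ->
  exists i1 d, [/\ i = i1 + d, matches i1 (i1 + p) (d + L) &
    i1 = 0 \/ w i1.-1 <> w (i1 + p).-1].
Proof.
elim: i L => [|i IH] L m; first by exists 0, 0; split=> //; left.
have [eqw|/eqP neqw] := eqVneq (w i) (w (i + p)); last first.
  by exists i.+1, 0; split; rewrite ?addn0 //; right; rewrite addSn.
have [|i1 [d [-> m1 lmax]]] := IH L.+1.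
  by case=> [|x]; rewrite ?addn0 // !addnS -!addSn ltnS => /m.
by exists i1, d.+1; split; rewrite ?addnS // addSn -addnS.
Qed.

(* With k, i0, p0 as in descent, w[i0, i0 + p0) must be c: if it contained a or b,
   its image under sigma^k would be too long for a cube. *)
Lemma cube_run i p L : 0 < p -> 2 * p <= L -> matches i (i + p) L ->
  exists k i0 d, [/\ p = trib k, i = iter k.+1 blk i0 + d, w i0 = c,
    d + L <= pal_size k.+1 & matches d i L].
Proof.
move=> p_gt0 leL /matches_left_max[i1 [d [-> m lmax]]].
have [k [i0 [p0 [p0_gt0 def_i1 def_j1 le_e m0]]]] := descent p_gt0 m lmax.
case: k def_i1 def_j1 le_e => [|k] def_i1 def_j1 le_e.
  by move: le_e; rewrite pal_size0; lia.
have le_p n : n <= p0 -> iter k.+1 blk (i0 + n) <= i1 + p.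
  by move=> len; rewrite def_j1 iter_blk_mono leq_add2l.
(* Here 4p <= 2 [pal_size k.+1] = t_(k+2) + t_k - 3 < 3 t_(k+1). *)
have le1 : trib k.+1 <= p -> False.
  by move: (pal_size_closed k) (trib_double k.+1) (trib_ltS k); lia.
have := le_p 1 p0_gt0; rewrite addn1 iter_blk_succ -def_i1 leq_add2l => lenp.
case def_x: (w i0) lenp => lenp.
- by case: le1; rewrite -size_iter_sigma_a.
- have {lenp}: trib k + size (iter k sigma [:: c]) <= p.
    by rewrite -size_iter_sigma_b.
  case: k le_e {le1 le_p def_j1 def_i1} => [|k] le_e.
    by move: (pal_size_closed 0); rewrite trib0 trib2 /=; lia.
  rewrite size_iter_sigma_c.
  by move: (pal_size_closed k.+1) (trib_double k.+1) (tribSSS k); lia.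
exists k, i0, d; split=> //; last 2 first.
- by rewrite def_i1.
- by move=> x hx; rewrite -addnA -m0 ?add0n // ltn_add2l.
have [p0_le1|p0_gt1] := leqP p0 1.
  have p0_1 : p0 = 1 by lia.
  move: def_j1; rewrite p0_1 addn1 iter_blk_succ -def_i1 def_x size_iter_sigma_c.
  exact: addnI.
case: le1; move: (le_p 2 p0_gt1); rewrite addn2 iter_blk_succ w_after_c //.
by rewrite iter_blk_succ -def_i1 size_iter_sigma_a; lia.
Qed.

(** Iterating [matches_blk] from the empty match: every block boundary of level k starts a copy of
    [pal k]. This supplies the repetitions that [descent] allows. *)
Lemma matches_pal k i : matches 0 (iter k blk i) (pal_size k).
Proof.
elim: k => [|k IH]; first by rewrite pal_size0 => x.
by have [_] := matches_blk IH; rewrite add0n blk0 subn0 -pal_size_blk.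
Qed.

(** * Cube roots of a prefix *)

Definition fac (q l : nat) : seq letter := map w (iota q l).

Lemma fac_eqP i j l : fac i l = fac j l <-> matches i j l.
Proof.
split=> [eq_f x hx|m].
  have := congr1 (nth a ^~ x) eq_f.
  by rewrite !(nth_map 0) ?size_iota // !nth_iota.
apply: (@eq_from_nth _ a); rewrite !size_map !size_iota // => x hx.
by rewrite !(nth_map 0) ?size_iota // !nth_iota // m.
Qed.

Lemma infix_prefixP v n :
  infix v (mkseq w n) <-> exists q, q + size v <= n /\ v = fac q (size v).
Proof.
split=> [/infixP[s [s' def_w]]|[q [le_n ->]]].
  have sz : n = size s + (size v + size s').
    by rewrite -!size_cat -def_w size_mkseq.
  exists (size s); split; first by rewrite sz addnA leq_addr.
  move: def_w; rewrite sz /mkseq !iotaD !map_cat => /eqP.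
  rewrite eqseq_cat ?size_map ?size_iota // => /andP[_].
  by rewrite eqseq_cat ?size_map ?size_iota // => /andP[/eqP/esym].
apply/infixP.
exists (fac 0 q), (fac (q + size v) (n - (q + size v))).
by rewrite -!map_cat -!iotaD addnA subnKC.
Qed.

Lemma matches_double q p : matches q (q + p) (2 * p) <->
  matches q (q + p) p /\ matches q (q + p + p) p.
Proof.
split=> [m|[m1 m2] x hx].
  have m1 : matches q (q + p) p by move=> x hx; apply: m; lia.
  split=> // x hx; have hpx : p + x < 2 * p by lia.
  by rewrite m1 //; have := m _ hpx; rewrite !addnA.
have [/m1 //|le_px] := ltnP x p.
have -> : q + p + x = q + p + p + (x - p) by lia.
have -> : q + x = q + p + (x - p) by lia.
by rewrite -m1 ?m2 //; lia.
Qed.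

Lemma mem_cube_roots_prefix u n : u \in cube_roots (mkseq w n) <->
  exists q, [/\ 0 < size u, q + 3 * size u <= n, u = fac q (size u) &
                matches q (q + size u) (2 * size u)].
Proof.
rewrite mem_cube_roots -size_eq0 -lt0n; split.
  case/andP=> u_gt0 /infix_prefixP[q]; rewrite !size_cat => -[le_n].
  rewrite /fac !iotaD !map_cat => /eqP.
  rewrite eqseq_cat ?size_map ?size_iota // => /andP[/eqP eq1].
  rewrite eqseq_cat ?size_map ?size_iota // => /andP[/eqP eq2 /eqP eq3].
  exists q; split=> //; first by lia.
  by apply/matches_double; split; apply/fac_eqP; rewrite /fac -eq1.
case=> q [u_gt0 le_n def_u /matches_double[/fac_eqP m1 /fac_eqP m2]].
rewrite u_gt0; apply/infix_prefixP; exists q.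
rewrite !size_cat /fac !iotaD !map_cat; split; first by lia.
by rewrite -![map w _]/(fac _ _) -m1 -m2 -def_u.
Qed.

Lemma cube_rootsE u n : u \in cube_roots (mkseq w n) <->
  exists K d, [/\ d < cube_number K, first_end K + d <= n & u = fac d (trib K)].
Proof.
rewrite /cube_number /first_end; split.
  case/mem_cube_roots_prefix=> q [u_gt0 le_n def_u m].
  have [K [i0 [d [eq_p def_q w_i0 le_e m1]]]] := cube_run u_gt0 (leqnn _) m.
  exists K, d; split; first by lia.
    (* The first c has index 3, so no occurrence at offset d comes earlier than the one from that
       c. *)
    have : iter K.+1 blk 3 <= iter K.+1 blk i0 by rewrite iter_blk_mono w_c_ge3.
    by move: (iter_blk3 K); lia.
  rewrite {1}def_u -eq_p; symmetry; apply/fac_eqP => x hx.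
  by apply: m1; lia.
case=> K [d [lt_d le_n ->]].
have p_gt0 : 0 < trib K := leq_ltn_trans (leq0n K) (trib_gt K).
have sz : size (fac d (trib K)) = trib K by rewrite size_map size_iota.
have S4 : iter K.+1 blk 3 + trib K = iter K.+1 blk 4 by rewrite iter_blk4 iter_blk3.
apply/mem_cube_roots_prefix; exists (iter K.+1 blk 3 + d); rewrite sz; split=> //.
- by move: (iter_blk3 K); lia.
- by apply/fac_eqP => x hx; rewrite -addnA -matches_pal ?add0n //; lia.
move=> x hx; have -> : iter K.+1 blk 3 + d + trib K + x = iter K.+1 blk 4 + (d + x).
  by rewrite -S4; lia.
by rewrite -addnA -!matches_pal //; lia.
Qed.

(** The image of the first c has length t_K, and copies of [pal K.+1] start at both of its ends;
    their overlap gives the period. *)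
Lemma pal_periodic K x : x + trib K < pal_size K.+1 -> w (x + trib K) = w x.
Proof.
have S4 : iter K.+1 blk 3 + trib K = iter K.+1 blk 4 by rewrite iter_blk4 iter_blk3.
move=> hx; have := @matches_pal K.+1 3 _ hx; rewrite add0n => ->.
have -> : iter K.+1 blk 3 + (x + trib K) = iter K.+1 blk 4 + x.
  by rewrite -S4; lia.
by rewrite -matches_pal //; lia.
Qed.

(* Equal roots at offsets d < d' make w[d, d' + 2 t_K) a repetition of period
   d' - d < t_K, too long by cube_run. *)
Lemma fac_root_inj K d d' : d < cube_number K -> d' < cube_number K ->
  fac d (trib K) = fac d' (trib K) -> d = d'.
Proof.
rewrite /cube_number; wlog: d d' / d < d' => [W|lt_dd' _ hd' /fac_eqP m].
  have [/W //|lt hd hd' eqf|//] := ltngtP d d'.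
  by rewrite (W d' d).
(* The period t_K doubles the length of the match, as [cube_run] requires. *)
have m2 : matches d (d + (d' - d)) (2 * trib K).
  rewrite subnKC ?(ltnW lt_dd') // => x hx.
  have [/m //|le_x] := ltnP x (trib K).
  have -> : d + x = d + (x - trib K) + trib K by lia.
  have -> : d' + x = d' + (x - trib K) + trib K by lia.
  by rewrite !pal_periodic ?m //; lia.
have lt_p : d' - d < trib K.
  by move: (pal_size_closed K) (trib_double K) (trib_double K.+1); lia.
(* The period must be some t_k with k < K, but then 2 t_K exceeds [pal_size k.+1]. *)
have [||k [i0 [x [eq_k _ _ le_e _]]]] := cube_run _ _ m2; [lia | lia |].
move: lt_p; rewrite eq_k (leqW_mono trib_mono) => lt_k.
have : trib k.+1 <= trib K by rewrite trib_mono.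
by move: (pal_size_closed k) (trib_double k.+1) (trib_ltS k) le_e; lia.
Qed.

(** * Summation over the root lengths *)

Lemma C_sum n :
  C w n = \sum_(0 <= K < n) minn (cube_number K) (n.+1 - first_end K).
Proof.
(* Counts the offsets d with [first_end K + d <= n]; the truncated subtraction gives 0 when n <
   [first_end K]. *)
pose m K := minn (cube_number K) (n.+1 - first_end K).
pose roots := [seq fac d (trib K) | K <- iota 0 n, d <- iota 0 (m K)].
rewrite /C; have /perm_size-> : perm_eq (cube_roots (mkseq w n)) roots.
  apply: uniq_perm; first exact: cube_roots_uniq.
    apply: allpairs_uniq_dep; first exact: iota_uniq.
      by move=> K _; exact: iota_uniq.
    move=> _ _ /allpairsPdep[K [d [_ hd ->]]] /allpairsPdep[K' [d' [_ hd' ->]]] /=.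
    move=> eq_f; have eqK : K = K'.
      by apply: trib_inj; have := congr1 size eq_f; rewrite !size_map !size_iota.
    rewrite -eqK in hd' eq_f *; congr (Tagged _ _).
    move: hd hd'; rewrite !mem_iota /= /m !leq_min => /andP[hd _] /andP[hd' _].
    exact: fac_root_inj eq_f.
  move=> u; apply/idP/allpairsPdep.
    case/cube_rootsE=> K [d [hd le_n ->]]; exists K, d.
    rewrite !mem_iota /= /m leq_min hd; split=> //.
      by move: (trib_gt K.+3); rewrite /first_end in le_n *; lia.
    by lia.
  case=> K [d [_]]; rewrite mem_iota /= /m leq_min => /andP[hd le_n] ->.
  by apply/cube_rootsE; exists K, d; split=> //; lia.
rewrite size_allpairs_dep sumnE big_map /index_iota subn0.
by apply: eq_bigr => K _; rewrite size_iota.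
Qed.

Lemma C_small n : n < 58 -> C w n = 0.
Proof.
move=> lt_n; rewrite C_sum big1_seq // => K _; apply/eqP.
rewrite -leqn0 geq_min; have [le3|lt3] := leqP 3 K.
  have : first_end 3 <= first_end K by rewrite first_end_mono.
  by rewrite first_end3; lia.
have: \sum_(0 <= K < 3) cube_number K = 0.
  by move: (sum_cube_number 0); rewrite trib0 trib1; lia.
move: lt3 {lt_n}; rewrite !big_nat_recr //= big_geq //.
by case: K => [|[|[|]]] //; lia.
Qed.

Lemma C_bracket n M : first_end M <= n < first_end M.+1 ->
  C w n = \sum_(0 <= K < M) cube_number K
          + minn (cube_number M) (n.+1 - first_end M).
Proof.
case/andP=> lo hi; have lt_Mn : M < n.
  by move: lo (trib_gt M.+3); rewrite /first_end; lia.
rewrite C_sum (big_cat_nat (leq0n M) (ltnW lt_Mn)) /=.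
rewrite (big_ltn lt_Mn); congr (_ + _).
  apply: eq_big_nat => K /andP[_ lt_K]; apply/minn_idPl.
  have : first_end K.+1 <= first_end M by rewrite first_end_mono.
  by move: (last_end_lt K); lia.
rewrite [X in _ + X]big_nat [X in _ + X]big1 ?addn0 // => K /andP[lt_K _].
have : first_end M.+1 <= first_end K by rewrite first_end_mono.
by lia.
Qed.

(** The bound on n is the position where the last root of length t_(j+3) first completes its cube;
    up to there each new position adds one root. *)
Lemma C_linear n j : first_end j.+3 <= n < first_end j.+4 ->
  2 * n + 3 + trib j.+4 <= 3 * trib j.+4.+2 ->
  2 * C w n + j + 1 + 3 * trib j.+4.+1 + trib j.+4 + 4 * trib j.+3 = 2 * n.
Proof.
move=> bounds le_n; rewrite (C_bracket bounds) (minn_idPr _).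
  move: bounds (sum_cube_number j); rewrite /first_end.
  set s := (\sum_(0 <= K < j.+3) _).
  move: (tribSSS j) (tribSSS j.+1) (tribSSS j.+2) (tribSSS j.+3).
  by lia.
move: le_n (cube_number_closed j.+3) (tribSSS j.+3); rewrite /first_end.
by lia.
Qed.

Lemma C_plateau n j : first_end j.+3 <= n < first_end j.+4 ->
  3 * trib j.+4.+2 < 2 * n + 3 + trib j.+4 ->
  2 * C w n + j + 4 = trib j.+2 + trib j.+1.
Proof.
move=> bounds lt_n; rewrite (C_bracket bounds) (minn_idPl _).
  rewrite -big_nat_recr // -(sum_cube_number j.+1) /=.
  by lia.
move: lt_n (cube_number_closed j.+3) (tribSSS j.+3); rewrite /first_end.
by lia.
Qed.

End TribonacciWord.

(** * Integer indices and the closed formula *)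

Lemma bracket_int (m : int) n : 58 <= n -> (0 < m)%R ->
  t (m - 1)%R + 2 * t (m - 4)%R <= n < t m + 2 * t (m - 3)%R ->
  exists2 j : nat, m = j.+4.+3 & first_end j.+3 <= n < first_end j.+4.
Proof.
move=> n58; case: m => [[|[|[|[|M]]]]|m] // _;
  (* For m at most 3 the upper bound is at most t_3 + 2 t_0 = 9. *)
  try by case/andP=> _ lt_n; have : n < 9 by [apply: leq_trans lt_n _]; lia.
have -> : (Posz M.+4 - 1 = M.+3)%R by lia.
have -> : (Posz M.+4 - 4 = M)%R by lia.
have -> : (Posz M.+4 - 3 = M.+1)%R by lia.
rewrite !tribE -/(first_end M) -/(first_end M.+1) => bounds.
have : first_end 3 < first_end M.+1 by rewrite first_end3; lia.
rewrite (leqW_mono first_end_mono) => lt3.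
exists (M - 3); first by lia.
by rewrite (_ : (M - 3).+3 = M) //; lia.
Qed.

Local Open Scope ring_scope.

Theorem theoremC (w : nat -> letter) (hw : tribonacci_word w) (n : nat) :
  ((n <= 57)%N -> C w n = 0%N)
  /\
  ((58 <= n)%N ->
     (exists! m : int, 0 < m /\
        (t (m - 1) + 2 * t (m - 4) <= n < t m + 2 * t (m - 3))%N)
     /\
     (forall m : int, 0 < m ->
        (t (m - 1) + 2 * t (m - 4) <= n < t m + 2 * t (m - 3))%N ->
        7 <= m /\
        (C w n)%:R =
          (if n%:R <= (3 * (t (m - 1))%:R - (t (m - 3))%:R - 3) / 2 :> rat
           then n%:R - (3 * (t (m - 2))%:R + (t (m - 3))%:R
                        + 4 * (t (m - 4))%:R + m%:~R - 6) / 2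
           else ((t (m - 5))%:R + (t (m - 6))%:R - m%:~R + 3) / 2) :> rat)).
Proof.
split=> [le_n|n58]; first exact: C_small.
split.
  have [j bounds] := first_end_bracket _ n58.
  exists j.+4.+3; split.
    split=> //.
    have -> : Posz j.+4.+3 - 1 = j.+4.+2 by lia.
    have -> : Posz j.+4.+3 - 4 = j.+3 by lia.
    have -> : Posz j.+4.+3 - 3 = j.+4 by lia.
    by rewrite !tribE.
  move=> m' [m'_gt0 /(bracket_int n58 m'_gt0)[j' -> bounds']].
  (* Both brackets contain n, so each starts before the other ends. *)
  have : (first_end j.+3 < first_end j'.+4)%N by lia.
  have : (first_end j'.+3 < first_end j.+4)%N by lia.
  by rewrite !(leqW_mono first_end_mono); lia.
move=> m m_gt0 /(bracket_int n58 m_gt0)[j -> bounds]; split; first by lia.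
have -> : Posz j.+4.+3 - 1 = j.+4.+2 by lia.
have -> : Posz j.+4.+3 - 2 = j.+4.+1 by lia.
have -> : Posz j.+4.+3 - 3 = j.+4 by lia.
have -> : Posz j.+4.+3 - 4 = j.+3 by lia.
have -> : Posz j.+4.+3 - 5 = j.+2 by lia.
have -> : Posz j.+4.+3 - 6 = j.+1 by lia.
rewrite !tribE.
have -> : (Posz j.+4.+3)%:~R = j%:R + 7 :> rat by rewrite -natrD addnC.
have [le_n|lt_n] := leqP (2 * n + 3 + trib j.+4) (3 * trib j.+4.+2).
  have := congr1 (fun x => x%:R : rat) (C_linear hw bounds le_n).
  move: le_n; rewrite -(ler_nat rat) !(natrD, natrM) => le_n eqC.
  by rewrite ifT; lra.
have := congr1 (fun x => x%:R : rat) (C_plateau hw bounds lt_n).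
move: lt_n; rewrite -(ltr_nat rat) !(natrD, natrM) => lt_n eqC.
by rewrite ifF; [lra | apply/negbTE; rewrite -ltNge; lra].
Qed.
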